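(* For every positive integer $n$ and every integer $p$: \[ \sum_{j = 0}^{\lfloor n/2 \rfloor} ( - 1)^j \frac{n}{n - j}\binom{n-j}{j}P_{p + n - 3j} = ( - 1)^n (Q_nP_p-P_{n+p} ), \] \[ \sum_{j = 0}^{\lfloor n/2 \rfloor} ( - 1)^j \binom{n-j}{j}P_{p + n - 3j} = ( - 1)^{n - 1}(P_{p+1}P_{n-3}-P_pP_{n-2}), \] \[ \sum_{j = 0}^{\lfloor n/2 \rfloor} ( - 1)^j \frac{n}{n - j}\binom{n-j}{j}P_{p - 4n + 8j} = P_{p + n} Q_{2n} - P_{p + 3n}, \] \[ \sum_{j = 0}^{\lfloor n/2 \rfloor} ( - 1)^j \binom{n-j}{j}P_{p - 4n + 8j} = P_{p+n} P_{2n-2} - P_{p + n - 1}P_{2n-1}, \] \[ \sum_{j = 0}^{\lfloor n/2 \rfloor} ( - 1)^j \frac{n}{n - j}\binom{n-j}{j}P_{p - 3n + 8j} = P_{2n+p} Q_{2n} - P_{p+4n}, \] \[ \sum_{j = 0}^{\lfloor n/2 \rfloor} ( - 1)^j \binom{n-j}{j}P_{p - 3n + 8j} = P_{2n+p} P_{2n-2} - P_{2n+p-1}P_{2n-1}. \]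
   Context: The Padovan numbers $P_n$ are defined for all integers $n$ by $P_0=P_1=P_2=1$ and $P_n=P_{n-2}+P_{n-3}$ for all integers $n$ (extended to negative indices via $P_n=P_{n+3}-P_{n+1}$). The Perrin numbers $Q_n$ are defined for all integers $n$ by $Q_0=3$, $Q_1=0$, $Q_2=2$ and $Q_n=Q_{n-2}+Q_{n-3}$ for all integers $n$. *)

(* Defs.v *)
From mathcomp Require Import all_boot all_order all_algebra.
From mathcomp Require Import zify ring.
Set Implicit Arguments.
Unset Strict Implicit.
Unset Printing Implicit Defensive.
Import Order.TTheory GRing.Theory Num.Theory.
Local Open Scope ring_scope.

(* The state (a, b, c) stands for (u_k, u_(k+1), u_(k+2)); one step forward
   uses u_(k+3) = u_(k+1) + u_k, one step backward uses
   u_(k-1) = u_(k+2) - u_k. *)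
Fixpoint forward (a b c : int) (m : nat) : int :=
  if m is m'.+1 then forward b c (b + a) m' else a.

Fixpoint backward (a b c : int) (m : nat) : int :=
  if m is m'.+1 then backward (c - a) a b m' else a.

(* The two-sided sequence with u_0 = a, u_1 = b, u_2 = c and
   u_n = u_(n-2) + u_(n-3) for all integers n. Negz m is -(m+1). *)
Definition two_sided (a b c : int) (n : int) : int :=
  match n with
  | Posz m => forward a b c m
  | Negz m => backward a b c m.+1
  end.

Definition padovan (n : int) : int := two_sided 1 1 1 n.

Definition perrin (n : int) : int := two_sided 3 0 2 n.

Lemma forward_rec a b c m :
  forward a b c m.+3 = forward a b c m.+1 + forward a b c m.
Proof. by elim: m a b c => [|m IHm] a b c //=; rewrite -IHm. Qed.

Lemma backward_rec a b c m :
  backward a b c m.+3 = backward a b c m - backward a b c m.+2.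
Proof.
elim: m a b c => [|m IHm] a b c; last exact: IHm.
by rewrite /=; ring.
Qed.

Lemma two_sided_rec a b c n :
  two_sided a b c n = two_sided a b c (n - 2) + two_sided a b c (n - 3).
Proof.
case: n => [[|[|[|m]]]|m]; try by rewrite /=; ring.
  have -> : m.+3%:Z - 2 = m.+1%:Z by lia.
  have -> : m.+3%:Z - 3 = m%:Z by lia.
  exact: forward_rec.
have -> : Negz m - 2 = Negz m.+2 by lia.
have -> : Negz m - 3 = Negz m.+3 by lia.
by rewrite /two_sided (backward_rec a b c m.+1) addrCA subrr addr0.
Qed.

Lemma padovan_init : [/\ padovan 0 = 1, padovan 1 = 1 & padovan 2 = 1].
Proof. by []. Qed.

Lemma padovan_rec n : padovan n = padovan (n - 2) + padovan (n - 3).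
Proof. exact: two_sided_rec. Qed.

Lemma perrin_init : [/\ perrin 0 = 3, perrin 1 = 0 & perrin 2 = 2].
Proof. by []. Qed.

Lemma perrin_rec n : perrin n = perrin (n - 2) + perrin (n - 3).
Proof. exact: two_sided_rec. Qed.

(* Main.v *)
(* By Pascal's rule, the sum over j of (-1)^j C(n-j, j) P_(p+an+dj), written
   U n p, satisfies U (n+2) p = U (n+1) (p+a) - U n (p+2a+d), and U 0 p = P_p,
   U 1 p = P_(p+a). For (a, d) = (1, -3), (-4, 8), (-3, 8) the closed forms obey
   the same recursion. Since n/(n-j) C(n-j, j) = 2 C(n-j, j) - C(n-1-j, j), the
   weighted sums are 2 U n p - U (n-1) (p+a). Every resulting identity becomes
   a polynomial one once each index is expanded by the addition formula for
   u_(q+m) in terms of u_q, u_(q+1), u_(q+2). *)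
Require Import Defs.
From mathcomp Require Import all_boot all_order all_algebra.
From mathcomp Require Import zify ring.
Import Order.TTheory GRing.Theory Num.Theory.
Local Open Scope ring_scope.

(** * Integer-indexed recurrences and the addition formula *)

(** Three consecutive zeros spread both ways: upward by the recursion itself, downward by solving it
    for its last term. *)
Lemma recurrence_eq0 (g : int -> int) :
  (forall k, g k = g (k - 2) + g (k - 3)) ->
  g 0 = 0 -> g 1 = 0 -> g 2 = 0 -> forall k, g k = 0.
Proof.
move=> grec g0 g1 g2.
have up (m : nat) : [/\ g m = 0, g m.+1 = 0 & g m.+2 = 0].
  elim: m => [|m [h0 h1 h2]]; first by [].
  split=> //; rewrite grec.
  have -> : m.+3%:Z - 2 = m.+1%:Z by lia.
  have -> : m.+3%:Z - 3 = m%:Z by lia.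
  by rewrite h0 h1.
have down (m : nat) : [/\ g (- m%:Z) = 0, g (1 - m%:Z) = 0 & g (2 - m%:Z) = 0].
  elim: m => [|m [h0 h1 h2]]; first by [].
  (* In this instance only the term at -(m+1) is not yet known to vanish. *)
  have := grec (2 - m%:Z).
  have -> : 2 - m%:Z - 2 = - m%:Z by lia.
  have -> : 2 - m%:Z - 3 = - m.+1%:Z by lia.
  have -> : 1 - m.+1%:Z = - m%:Z by lia.
  have -> : 2 - m.+1%:Z = 1 - m%:Z by lia.
  by rewrite h0 h1 h2 add0r => <-.
move=> k; have [k_ge0|k_lt0] := leP 0 k.
  by rewrite -(gez0_abs k_ge0); case: (up `|k|%N).
by rewrite -[k]opprK -(ltz0_abs k_lt0); case: (down `|k|%N).
Qed.

(** For fixed q both sides satisfy the recursion in m, so m = 0, 1, 2 suffice. The shifts -5, -3, -4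
    are chosen because they give the solutions with initial values (1,0,0), (0,1,0), (0,0,1). *)
Lemma two_sided_addition (a b c q m : int) :
  let u := two_sided a b c in
  u (q + m) = u q * padovan (m - 5) + u (q + 1) * padovan (m - 3)
              + u (q + 2) * padovan (m - 4).
Proof.
move=> u; apply/eqP; rewrite -subr_eq0; apply/eqP; move: m.
apply: (recurrence_eq0 (fun m => u (q + m) - (u q * padovan (m - 5)
  + u (q + 1) * padovan (m - 3) + u (q + 2) * padovan (m - 4)))); cbv beta.
- move=> k; rewrite {1}/u two_sided_rec -/u -!(addrA q).
  rewrite (padovan_rec (k - 5)) (padovan_rec (k - 3)) (padovan_rec (k - 4)).
  (* Shifts of k are commuted so that [ring] meets the same arguments of [padovan] on both sides. *)
  rewrite !(addrAC k (- 5)) !(addrAC k (- 3) (- 2)) !(addrAC k (- 4)); ring.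
- rewrite addr0.
  have [-> -> ->] : [/\ padovan (0 - 5) = 1, padovan (0 - 3) = 0
    & padovan (0 - 4) = 0] by [].
  ring.
- have [-> -> ->] : [/\ padovan (1 - 5) = 0, padovan (1 - 3) = 1
    & padovan (1 - 4) = 0] by [].
  ring.
- have [-> -> ->] : [/\ padovan (2 - 5) = 0, padovan (2 - 3) = 0
    & padovan (2 - 4) = 1] by [].
  ring.
Qed.

Lemma padovan_addition (q m : int) :
  padovan (q + m) = padovan q * padovan (m - 5) + padovan (q + 1) * padovan (m - 3)
                    + padovan (q + 2) * padovan (m - 4).
Proof. exact: two_sided_addition. Qed.

(** The addition formula at q = 0; the coefficients are Q_0 = 3 and Q_2 = 2, and Q_1 = 0 removes the
    middle term. *)
Lemma perrin_padovan (m : int) :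
  perrin m = 3 * padovan (m - 5) + 2 * padovan (m - 4).
Proof.
rewrite -[m in LHS]add0r /perrin two_sided_addition.
by rewrite (_ : two_sided 3 0 2 (0 + 1) = 0) // mul0r addr0.
Qed.

(* Here [e] must be provably [q + c] and [c] a literal: the right-hand side
   involves only the three state values at [q], with literal coefficients. *)
Tactic Notation "padovan_at" constr(e) constr(q) uconstr(c) :=
  let A := eval vm_compute in (padovan (c - 5)) in
  let B := eval vm_compute in (padovan (c - 3)) in
  let C := eval vm_compute in (padovan (c - 4)) in
  let E := fresh in
  (have E : padovan e = padovan q * A + padovan (q + 1) * B + padovan (q + 2) * C
    by (transitivity (padovan (q + c));
        [congr padovan; lia | exact: padovan_addition]));
  rewrite ?E {E}.

(** * The unweighted sums and their recursion *)

Definition alt_binomial_sum (a d : int) (n : nat) (p : int) : int :=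
  \sum_(0 <= j < (n./2).+1)
    (-1) ^+ j * 'C(n - j, j)%:R * padovan (p + a * n%:Z + d * j%:Z).

(** For j > n/2 the binomial vanishes, also where [n - j] is truncated to 0. Sums for different n
    can thus share a range. *)
Lemma alt_binomial_sum_widen (a d : int) (n N : nat) (p : int) : (n./2 < N)%N ->
  alt_binomial_sum a d n p = \sum_(0 <= j < N)
    (-1) ^+ j * 'C(n - j, j)%:R * padovan (p + a * n%:Z + d * j%:Z).
Proof.
move=> lt_nN; rewrite /alt_binomial_sum [RHS](big_cat_nat (n := (n./2).+1)) //=.
rewrite [X in _ = _ + X]big_nat_cond [X in _ = _ + X]big1 ?addr0 // => j.
rewrite andbT => /andP[lt_nj _].
by rewrite bin_small ?mulr0 ?mul0r //; lia.
Qed.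

Lemma alt_binomial_sum_rec (a d : int) (n : nat) (p : int) :
  alt_binomial_sum a d n.+2 p
  = alt_binomial_sum a d n.+1 (p + a) - alt_binomial_sum a d n (p + 2 * a + d).
Proof.
(* With these bounds all three sums have n+1 terms once j = 0 is split off the first two. *)
rewrite (@alt_binomial_sum_widen _ _ _ n.+2) ?(@alt_binomial_sum_widen _ _ n.+1 n.+2)
  ?(@alt_binomial_sum_widen _ _ n n.+1); try lia.
rewrite !(big_nat_recl n.+1) // !subn0 !bin0 -[RHS]addrA; congr (_ + _).
  by congr (_ * padovan _); lia.
rewrite -sumrB; apply: eq_big_nat => j /andP[_ lt_jn].
rewrite !subSS subSn; last by lia.
rewrite binS natrD exprS.
rewrite (_ : p + a + a * n.+1%:Z + d * j.+1%:Z
           = p + a * n.+2%:Z + d * j.+1%:Z); last by lia.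
rewrite (_ : p + 2 * a + d + a * n%:Z + d * j%:Z
           = p + a * n.+2%:Z + d * j.+1%:Z); last by lia.
ring.
Qed.

(** The recursion has order two in n but also moves p, so the induction carries two consecutive n
    and all p. *)
Lemma alt_binomial_sum_unique (a d : int) (R : nat -> int -> int) :
  (forall p, R 0%N p = padovan p) -> (forall p, R 1%N p = padovan (p + a)) ->
  (forall n p, R n.+2 p = R n.+1 (p + a) - R n (p + 2 * a + d)) ->
  forall n p, alt_binomial_sum a d n p = R n p.
Proof.
move=> R0 R1 RS n p.
suff: alt_binomial_sum a d n p = R n p /\
      forall q, alt_binomial_sum a d n.+1 q = R n.+1 q by case.
elim: n p => [|n IHn] p; split.
- by rewrite /alt_binomial_sum big_nat1 R0 /= mulr1 mul1r mulr0 mulr0 !addr0.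
- by move=> q; rewrite /alt_binomial_sum big_nat1 R1 /= mulr1 mul1r mulr0 mulr1 addr0.
- by case: (IHn p) => _ ->.
- move=> q; rewrite alt_binomial_sum_rec RS; case: (IHn (q + 2 * a + d)).
  by move=> -> ->.
Qed.

(** * The sums weighted by n/(n-j) *)

(** With N = n+1, multiply by N-j and use (N-j) C(N-1-j, j) = (N-2j) C(N-j, j); then 2(N-j) - (N-2j)
    = N. *)
Lemma lucas_weight (n j : nat) : (j <= n.+1./2)%N ->
  (n.+1%:R / (n.+1 - j)%:R) * 'C(n.+1 - j, j)%:R
  = 2 * 'C(n.+1 - j, j)%:R - 'C(n - j, j)%:R :> rat.
Proof.
move=> le_jn; have le_j : (j <= n)%N by lia.
have := mul_bin_down (n.+1 - j) j.
rewrite (_ : (n.+1 - j).-1 = n - j)%N; last by lia.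
move=> /(congr1 (fun k => k%:R : rat)); rewrite !natrM => h.
have nz : (n.+1 - j)%:R != 0 :> rat by rewrite pnatr_eq0; lia.
apply: (mulfI nz); rewrite mulrBr h.
rewrite (_ : (n.+1 - j - j)%:R = (n.+1 - j)%:R - j%:R :> rat); last first.
  by rewrite natrB //; lia.
rewrite (_ : n.+1%:R = (n.+1 - j)%:R + j%:R :> rat); last first.
  by rewrite -natrD; congr (_%:R); lia.
by field.
Qed.

Lemma lucas_alt_binomial_sum (a d : int) (n : nat) (p : int) :
  \sum_(0 <= j < (n.+1./2).+1)
    (-1) ^+ j * (n.+1%:R / (n.+1 - j)%:R) * 'C(n.+1 - j, j)%:R
      * (padovan (p + a * n.+1%:Z + d * j%:Z))%:~R
  = (2 * alt_binomial_sum a d n.+1 p - alt_binomial_sum a d n (p + a))%:~R :> rat.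
Proof.
rewrite /(alt_binomial_sum a d n.+1 p).
(* The sum for n may be one term shorter than the one for n+1. *)
rewrite (@alt_binomial_sum_widen _ _ n (n.+1./2).+1); last by lia.
rewrite mulr_sumr -sumrB raddf_sum.
apply: eq_big_nat => j /andP[_ lt_j].
rewrite -(mulrA ((-1) ^+ j)).
have -> : p + a + a * n%:Z + d * j%:Z = p + a * n.+1%:Z + d * j%:Z by lia.
rewrite lucas_weight //.
by rewrite /= !(rmorphB, rmorphM, rmorphXn, rmorphN, rmorph1, rmorph_nat) /=; ring.
Qed.

(** * Closed forms of the three unweighted sums *)

Lemma alt_binomial_sum_1_N3 (n : nat) (p : int) :
  alt_binomial_sum 1 (- 3) n p
  = - (-1) ^+ n * (padovan (p + 1) * padovan (n%:Z - 3)
                   - padovan p * padovan (n%:Z - 2)).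
Proof.
apply: (@alt_binomial_sum_unique 1 (- 3) (fun n p =>
  - (-1) ^+ n * (padovan (p + 1) * padovan (n%:Z - 3)
                 - padovan p * padovan (n%:Z - 2)))) => {n p} [p|p|n p].
- have [-> ->] : padovan (0%:Z - 3) = 0 /\ padovan (0%:Z - 2) = 1 by [].
  by ring.
- have [-> ->] : padovan (1%:Z - 3) = 1 /\ padovan (1%:Z - 2) = 0 by [].
  by ring.
(* Reducing every index to the base points n and p leaves a polynomial identity in the three values
   at each, and in (-1)^n. *)
padovan_at (n.+2%:Z - 3) n%:Z (-1).
padovan_at (n.+2%:Z - 2) n%:Z 0.
padovan_at (n.+1%:Z - 3) n%:Z (-2).
padovan_at (n.+1%:Z - 2) n%:Z (-1).
padovan_at (n%:Z - 3) n%:Z (-3).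
padovan_at (n%:Z - 2) n%:Z (-2).
padovan_at (p + 1 + 1) p 2.
padovan_at (p + 2 * 1 - 3 + 1) p 0.
padovan_at (p + 2 * 1 - 3) p (-1).
by rewrite !exprS; ring.
Qed.

Lemma alt_binomial_sum_N4_8 (n : nat) (p : int) :
  alt_binomial_sum (- 4) 8 n p
  = padovan (p + n%:Z) * padovan (2 * n%:Z - 2)
    - padovan (p + n%:Z - 1) * padovan (2 * n%:Z - 1).
Proof.
apply: (@alt_binomial_sum_unique (- 4) 8 (fun n p =>
  padovan (p + n%:Z) * padovan (2 * n%:Z - 2)
  - padovan (p + n%:Z - 1) * padovan (2 * n%:Z - 1))) => {n p} [p|p|n p].
- have [-> ->] : padovan (2 * 0%:Z - 2) = 1 /\ padovan (2 * 0%:Z - 1) = 0 by [].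
  by rewrite addr0; ring.
- have [-> ->] : padovan (2 * 1%:Z - 2) = 1 /\ padovan (2 * 1%:Z - 1) = 1 by [].
  padovan_at (p + 1%:Z - 1) p 0.
  padovan_at (p - 4) p (-4).
  by ring.
(* The base points are p+n and 2n; here 2a + d = 0, so the sum for n keeps its p. *)
padovan_at (p + n.+2%:Z - 1) (p + n%:Z) 1.
padovan_at (p + n.+2%:Z) (p + n%:Z) 2.
padovan_at (p - 4 + n.+1%:Z - 1) (p + n%:Z) (-4).
padovan_at (p - 4 + n.+1%:Z) (p + n%:Z) (-3).
padovan_at (p + 2 * (- 4) + 8 + n%:Z - 1) (p + n%:Z) (-1).
padovan_at (p + 2 * (- 4) + 8 + n%:Z) (p + n%:Z) 0.
padovan_at (2 * n.+2%:Z - 2) (2 * n%:Z) 2.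
padovan_at (2 * n.+2%:Z - 1) (2 * n%:Z) 3.
padovan_at (2 * n.+1%:Z - 2) (2 * n%:Z) 0.
padovan_at (2 * n.+1%:Z - 1) (2 * n%:Z) 1.
padovan_at (2 * n%:Z - 2) (2 * n%:Z) (-2).
padovan_at (2 * n%:Z - 1) (2 * n%:Z) (-1).
by ring.
Qed.

Lemma alt_binomial_sum_N3_8 (n : nat) (p : int) :
  alt_binomial_sum (- 3) 8 n p
  = padovan (2 * n%:Z + p) * padovan (2 * n%:Z - 2)
    - padovan (2 * n%:Z + p - 1) * padovan (2 * n%:Z - 1).
Proof.
apply: (@alt_binomial_sum_unique (- 3) 8 (fun n p =>
  padovan (2 * n%:Z + p) * padovan (2 * n%:Z - 2)
  - padovan (2 * n%:Z + p - 1) * padovan (2 * n%:Z - 1))) => {n p} [p|p|n p].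
- have [-> ->] : padovan (2 * 0%:Z - 2) = 1 /\ padovan (2 * 0%:Z - 1) = 0 by [].
  by rewrite mulr0 add0r; ring.
- have [-> ->] : padovan (2 * 1%:Z - 2) = 1 /\ padovan (2 * 1%:Z - 1) = 1 by [].
  padovan_at (2 * 1%:Z + p - 1) p 1.
  padovan_at (2 * 1%:Z + p) p 2.
  padovan_at (p - 3) p (-3).
  by ring.
(* The base points are 2n+p and 2n; here 2a + d = 2. *)
padovan_at (2 * n.+2%:Z + p - 1) (2 * n%:Z + p) 3.
padovan_at (2 * n.+2%:Z + p) (2 * n%:Z + p) 4.
padovan_at (2 * n.+1%:Z + (p - 3) - 1) (2 * n%:Z + p) (-2).
padovan_at (2 * n.+1%:Z + (p - 3)) (2 * n%:Z + p) (-1).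
padovan_at (2 * n%:Z + (p + 2 * (- 3) + 8) - 1) (2 * n%:Z + p) 1.
padovan_at (2 * n%:Z + (p + 2 * (- 3) + 8)) (2 * n%:Z + p) 2.
padovan_at (2 * n.+2%:Z - 2) (2 * n%:Z) 2.
padovan_at (2 * n.+2%:Z - 1) (2 * n%:Z) 3.
padovan_at (2 * n.+1%:Z - 2) (2 * n%:Z) 0.
padovan_at (2 * n.+1%:Z - 1) (2 * n%:Z) 1.
padovan_at (2 * n%:Z - 2) (2 * n%:Z) (-2).
padovan_at (2 * n%:Z - 1) (2 * n%:Z) (-1).
by ring.
Qed.

(** * Assembling the six identities *)

Lemma alt_binomial_sumE (a d : int) (n : nat) (p : int) (g : nat -> int) :
  (forall j, g j = p + a * n%:Z + d * j%:Z) ->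
  \sum_(0 <= j < (n./2).+1) (-1) ^+ j * 'C(n - j, j)%:R * padovan (g j)
  = alt_binomial_sum a d n p.
Proof. by move=> gE; apply: eq_bigr => j _; rewrite gE. Qed.

(** Reduces a rational identity to one between integers; [g] absorbs the way the index is
    written. *)
Lemma lucas_alt_binomial_sumE (a d : int) (n : nat) (p s : int) (g : nat -> int) :
  (forall j, g j = p + a * n.+1%:Z + d * j%:Z) ->
  2 * alt_binomial_sum a d n.+1 p - alt_binomial_sum a d n (p + a) = s ->
  \sum_(0 <= j < (n.+1./2).+1)
    (-1) ^+ j * (n.+1%:R / (n.+1 - j)%:R) * 'C(n.+1 - j, j)%:R
      * (padovan (g j))%:~R = s%:~R :> rat.
Proof.
move=> gE <-; rewrite -lucas_alt_binomial_sum.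
by apply: eq_bigr => j _; rewrite gE.
Qed.

Theorem theorem15 (n : nat) (p : int) (n_gt0 : (0 < n)%N) :
  (\sum_(0 <= j < (n./2).+1)
      (-1) ^+ j * (n%:R / (n - j)%:R) * 'C(n - j, j)%:R
        * (padovan (p + n%:Z - 3 * j%:Z))%:~R
    = (-1) ^+ n * ((perrin n%:Z)%:~R * (padovan p)%:~R
                   - (padovan (n%:Z + p))%:~R) :> rat)
  /\
  (\sum_(0 <= j < (n./2).+1)
      (-1) ^+ j * 'C(n - j, j)%:R * padovan (p + n%:Z - 3 * j%:Z)
    = (-1) ^+ (n - 1) * (padovan (p + 1) * padovan (n%:Z - 3)
                         - padovan p * padovan (n%:Z - 2)) :> int)
  /\
  (\sum_(0 <= j < (n./2).+1)
      (-1) ^+ j * (n%:R / (n - j)%:R) * 'C(n - j, j)%:R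
        * (padovan (p - 4 * n%:Z + 8 * j%:Z))%:~R
    = (padovan (p + n%:Z))%:~R * (perrin (2 * n%:Z))%:~R
      - (padovan (p + 3 * n%:Z))%:~R :> rat)
  /\
  (\sum_(0 <= j < (n./2).+1)
      (-1) ^+ j * 'C(n - j, j)%:R * padovan (p - 4 * n%:Z + 8 * j%:Z)
    = padovan (p + n%:Z) * padovan (2 * n%:Z - 2)
      - padovan (p + n%:Z - 1) * padovan (2 * n%:Z - 1) :> int)
  /\
  (\sum_(0 <= j < (n./2).+1)
      (-1) ^+ j * (n%:R / (n - j)%:R) * 'C(n - j, j)%:R
        * (padovan (p - 3 * n%:Z + 8 * j%:Z))%:~R
    = (padovan (2 * n%:Z + p))%:~R * (perrin (2 * n%:Z))%:~R
      - (padovan (p + 4 * n%:Z))%:~R :> rat)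
  /\
  (\sum_(0 <= j < (n./2).+1)
      (-1) ^+ j * 'C(n - j, j)%:R * padovan (p - 3 * n%:Z + 8 * j%:Z)
    = padovan (2 * n%:Z + p) * padovan (2 * n%:Z - 2)
      - padovan (2 * n%:Z + p - 1) * padovan (2 * n%:Z - 1) :> int).
Proof.
(* Writing the positive index as [n.+1] gives the weighted sums their predecessor n. *)
case: n n_gt0 => // n _; split; [|split; [|split; [|split; [|split]]]].
- rewrite (@lucas_alt_binomial_sumE 1 (- 3) n p ((-1) ^+ n.+1
    * (perrin n.+1%:Z * padovan p - padovan (n.+1%:Z + p)))); last 2 first.
  + by move=> j; lia.
  + rewrite !alt_binomial_sum_1_N3 perrin_padovan (addrC _ p).
    rewrite (padovan_addition p n.+1%:Z).
    padovan_at (n.+1%:Z - 5) n%:Z (-4).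
    padovan_at (n.+1%:Z - 4) n%:Z (-3).
    padovan_at (n.+1%:Z - 3) n%:Z (-2).
    padovan_at (n.+1%:Z - 2) n%:Z (-1).
    padovan_at (n%:Z - 3) n%:Z (-3).
    padovan_at (n%:Z - 2) n%:Z (-2).
    padovan_at (p + 1 + 1) p 2.
    by rewrite !exprS; ring.
  by rewrite !(rmorphM, rmorphB, rmorphXn, rmorphN, rmorph1).
- rewrite (@alt_binomial_sumE 1 (- 3) n.+1 p); last by move=> j; lia.
  by rewrite alt_binomial_sum_1_N3 subn1 exprS mulN1r opprK.
- rewrite (@lucas_alt_binomial_sumE (- 4) 8 n p (padovan (p + n.+1%:Z)
    * perrin (2 * n.+1%:Z) - padovan (p + 3 * n.+1%:Z))); last 2 first.
  + by move=> j; lia.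
  + rewrite !alt_binomial_sum_N4_8 perrin_padovan.
    (* This splitting uses the same two base points as the product on the right. *)
    have -> : p + 3 * n.+1%:Z = p + n.+1%:Z + 2 * n.+1%:Z by lia.
    rewrite (padovan_addition _ (2 * n.+1%:Z)).
    padovan_at (p - 4 + n%:Z - 1) (p + n.+1%:Z) (-6).
    padovan_at (p - 4 + n%:Z) (p + n.+1%:Z) (-5).
    padovan_at (p + n.+1%:Z - 1) (p + n.+1%:Z) (-1).
    padovan_at (2 * n%:Z - 2) (2 * n.+1%:Z) (-4).
    padovan_at (2 * n%:Z - 1) (2 * n.+1%:Z) (-3).
    padovan_at (2 * n.+1%:Z - 1) (2 * n.+1%:Z) (-1).
    padovan_at (2 * n.+1%:Z - 2) (2 * n.+1%:Z) (-2).
    padovan_at (2 * n.+1%:Z - 3) (2 * n.+1%:Z) (-3).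
    padovan_at (2 * n.+1%:Z - 4) (2 * n.+1%:Z) (-4).
    padovan_at (2 * n.+1%:Z - 5) (2 * n.+1%:Z) (-5).
    by ring.
  by rewrite rmorphB rmorphM.
- rewrite (@alt_binomial_sumE (- 4) 8 n.+1 p); last by move=> j; lia.
  exact: alt_binomial_sum_N4_8.
- rewrite (@lucas_alt_binomial_sumE (- 3) 8 n p (padovan (2 * n.+1%:Z + p)
    * perrin (2 * n.+1%:Z) - padovan (p + 4 * n.+1%:Z))); last 2 first.
  + by move=> j; lia.
  + rewrite !alt_binomial_sum_N3_8 perrin_padovan.
    (* Again split along the two indices of the product. *)
    have -> : p + 4 * n.+1%:Z = 2 * n.+1%:Z + p + 2 * n.+1%:Z by lia.
    rewrite (padovan_addition _ (2 * n.+1%:Z)).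
    padovan_at (2 * n%:Z + (p - 3) - 1) (2 * n.+1%:Z + p) (-6).
    padovan_at (2 * n%:Z + (p - 3)) (2 * n.+1%:Z + p) (-5).
    padovan_at (2 * n.+1%:Z + p - 1) (2 * n.+1%:Z + p) (-1).
    padovan_at (2 * n%:Z - 2) (2 * n.+1%:Z) (-4).
    padovan_at (2 * n%:Z - 1) (2 * n.+1%:Z) (-3).
    padovan_at (2 * n.+1%:Z - 1) (2 * n.+1%:Z) (-1).
    padovan_at (2 * n.+1%:Z - 2) (2 * n.+1%:Z) (-2).
    padovan_at (2 * n.+1%:Z - 3) (2 * n.+1%:Z) (-3).
    padovan_at (2 * n.+1%:Z - 4) (2 * n.+1%:Z) (-4).
    padovan_at (2 * n.+1%:Z - 5) (2 * n.+1%:Z) (-5).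
    by ring.
  by rewrite rmorphB rmorphM.
- rewrite (@alt_binomial_sumE (- 3) 8 n.+1 p); last by move=> j; lia.
  exact: alt_binomial_sum_N3_8.
Qed.
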